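(* Let $\{Z_n\}_{n\in\mathbb{N}_0}$ be a defective Galton-Watson process in a varying environment $v=\{f_n\}_{n\in\mathbb{N}}$. For each $n\in\mathbb{N}$, $$P[\tau_a >n] \le \inf_{0\le i\le n} \mu_i.$$ Moreover, if there exists a constant $c>0$ such that for all $n\in\mathbb{N}$, $$E[X_{n1}^2; X_{n1}\ge 2] \le c\, E[X_{n1}; X_{n1} \ge 2],$$ then there is a constant $c'>0$ such that, for all sufficiently large $n$, $$\frac{E[Z_n]^2}{E[Z_n^2]} \le P[\tau_a >n] \le c'\,\frac{E[Z_n]^2}{E[Z_n^2]} .$$
   Context: $\mathbb{N}=\{1,2,\dots\}$, $\mathbb{N}_0=\mathbb{N}\cup\{0\}$, $\Delta\notin\mathbb{N}_0$ is an extra ''graveyard'' state, and $\mathbb{N}_\Delta=\mathbb{N}_0\cup\{\Delta\}$. For each $n\in\mathbb{N}$, $f_n$ is a possibly defective distribution on $\mathbb{N}_0$: weights $f_n[k]\ge 0$, $k\in\mathbb{N}_0$, with $\sum_k f_n[k]\le 1$; its generating function is also denoted $f_n(s)=\sum_{k\ge0}f_n[k]s^k$, $s\in[0,1]$; $f_n'(1)=\sum_k kf_n[k]$. Standing assumption: $0<f_n'(1)<\infty$ for all $n\ge1$. A defective Galton-Watson process in a varying environment $v=\{f_n\}_{n\in\mathbb{N}}$ is the process defined by $Z_0=1$, $Z_n=\sum_{j=1}^{Z_{n-1}}X_{nj}$, $n\in\mathbb{N}$, where $\{X_{nj}:n,j\in\mathbb{N}\}$ are independent $\mathbb{N}_\Delta$-valued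 random variables with $P[X_{nj}=k]=f_n[k]$ for $k\in\mathbb{N}_0$ and $P[X_{nj}=\Delta]=1-f_n(1)$. Conventions: $\Delta+k=\Delta$ for $k\in\mathbb{N}_\Delta$, and $\sum_{j=1}^{\Delta}k_j=\Delta$; empty sums are $0$. Thus $0$ and $\Delta$ are absorbing. For an $\mathbb{N}_\Delta$-valued $X$, $E[h(X)]$ means $E[h(X);X\ne\Delta]$ (so $E[Z_n]$ and $E[Z_n^2]$ are taken over $\{Z_n\neq\Delta\}$), and events such as $\{X\ge 2\}$ do not include $X=\Delta$. Notation: $\mu_0=1$, $\mu_n=\prod_{i=1}^n f_i'(1)$; $\tau_0=\min\{n\in\mathbb{N}:Z_n=0\}$, $\tau_\Delta=\min\{n\in\mathbb{N}:Z_n=\Delta\}$ (with $\min\varnothing=\infty$), $\tau_a=\tau_0\wedge\tau_\Delta$. *)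

(* Defs.v *)
From HB Require Import structures.
From mathcomp Require Import all_boot all_order all_algebra.
From mathcomp Require Import finmap.
From mathcomp Require Import all_classical all_reals all_analysis.

Set Implicit Arguments.
Unset Strict Implicit.
Unset Printing Implicit Defensive.
Import Order.TTheory GRing.Theory Num.Theory.
Import numFieldNormedType.Exports.

Local Open Scope classical_set_scope.
Local Open Scope ring_scope.

(* [None] is the graveyard state; every subset is measurable. *)
Definition Ndelta : Type := option nat.
Definition Delta : Ndelta := None.
Definition alive (k : nat) : Ndelta := Some k.

HB.instance Definition _ := Choice.on Ndelta.
HB.instance Definition _ := isPointed.Build Ndelta Delta.
HB.instance Definition _ := @isMeasurable.Build default_measure_display
  Ndelta discrete_measurable discrete_measurable0
  discrete_measurableC discrete_measurableU.

Definition addD (a b : Ndelta) : Ndelta :=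
  if a is Some m then if b is Some k then alive (m + k) else Delta else Delta.

(* \sum_(1 <= j <= a) x j, with the convention that a sum up to Delta is Delta *)
Definition sumD (a : Ndelta) (x : nat -> Ndelta) : Ndelta :=
  if a is Some m then \big[addD/alive 0]_(1 <= j < m.+1) x j else Delta.

Section environment.
Context {R : realType}.
Local Open Scope ereal_scope.

Definition genfun (g : nat -> R) (s : R) : \bar R :=
  \sum_(0 <= k <oo) (g k * s ^+ k)%:E.

(* g'(1), as the series of its coefficients *)
Definition gmean (g : nat -> R) : \bar R :=
  \sum_(0 <= k <oo) (k%:R * g k)%:E.

Definition defective_distr (g : nat -> R) : Prop :=
  (forall k, (0 <= g k)%R) /\ \sum_(0 <= k <oo) (g k)%:E <= 1.

(* Environments are indexed by n >= 1: the value f 0 is never used. *)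
Definition varying_env (f : nat -> nat -> R) : Prop :=
  forall n, (0 < n)%N ->
    defective_distr (f n) /\ 0 < gmean (f n) /\ gmean (f n) < +oo.

Definition mu (f : nat -> nat -> R) (n : nat) : \bar R :=
  \prod_(1 <= i < n.+1) gmean (f i).

End environment.

Section process.
Context {d : measure_display} {T : measurableType d} {R : realType}.
Variable P : probability T R.
Local Open Scope ereal_scope.

Definition mutually_independent {I : choiceType} (D : set I)
    (X : I -> {RV P >-> Ndelta}) : Prop :=
  forall (J : {fset I}) (A : I -> set Ndelta),
    [set` J] `<=` D -> (forall i, measurable (A i)) ->
    P (\bigcap_(i in [set` J]) (X i @^-1` A i)) =
    \prod_(i <- J) P (X i @^-1` A i).

(* X n j is the offspring variable X_{nj}, for n, j >= 1 only. *)
Definition offspring (f : nat -> nat -> R)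
    (X : nat -> nat -> {RV P >-> Ndelta}) : Prop :=
  [/\ mutually_independent [set p : nat * nat | (0 < p.1)%N /\ (0 < p.2)%N]
        (fun p => X p.1 p.2),
      forall n j k, (0 < n)%N -> (0 < j)%N ->
        P (X n j @^-1` [set alive k]) = (f n k)%:E
    & forall n j, (0 < n)%N -> (0 < j)%N ->
        P (X n j @^-1` [set Delta]) = 1 - genfun (f n) 1%R].

Fixpoint dgw (X : nat -> nat -> {RV P >-> Ndelta}) (n : nat) : T -> Ndelta :=
  if n is n'.+1 then fun w => sumD (dgw X n' w) (fun j => X n j w)
  else fun=> alive 1.

(* E[h(Y); Y \in A, Y != Delta] *)
Definition expectD (h : nat -> R) (Y : T -> Ndelta) (A : set nat) : \bar R :=
  \int[P]_(w in Y @^-1` (alive @` A)) (oapp h 0%R (Y w))%:E.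

(* First n >= 1 at which the path z is at state a; the infimum of the empty
   set is +oo. *)
Definition hitting_time (z : nat -> Ndelta) (a : Ndelta) : \bar R :=
  ereal_inf [set n%:R%:E | n in [set n | (0 < n)%N /\ z n = a]].

Definition tau_a (Z : nat -> T -> Ndelta) (w : T) : \bar R :=
  mine (hitting_time (Z ^~ w) (alive 0)) (hitting_time (Z ^~ w) Delta).

End process.

(* Main.v *)
(* The first bound is Markov's inequality: killing only lowers the mean, so
   E[Z_i] <= mu_i and P[tau_a > n] <= P[Z_i >= 1] <= E[Z_i] for i <= n.

   The lower bound in the second part is the Cauchy-Schwarz inequality.  For the
   upper bound, let r_i and q_i be the probabilities that the family of one
   individual of generation i avoids the graveyard, resp. is extinct, at time n,
   and let a_i and b_i be the first two factorial moments of its size at time n.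
   Then r_(i-1) = f_i(r_i), q_(i-1) = f_i(q_i), a_(i-1) = f_i'(r_i) a_i and
   b_(i-1) = f_i''(r_i) a_i^2 + f_i'(r_i) b_i, and the inequality
   (r_i - q_i) (b_i + a_i) <= max(1, 2c) a_i^2 propagates from i to i - 1; for
   i = 0 it is the claim.  The propagation rests on
     f'(r) (r - q) - (f(r) - f(q)) >= (r - q)^2 sum_k (k - 1) f[k] r^(k-2)
   and on f''(r) <= 2c sum_k (k - 1) f[k] r^(k-2), which follows from the moment
   hypothesis because that hypothesis survives the damping of f[k] by r^k. *)
Require Import Defs.
From HB Require Import structures.
From mathcomp Require Import all_boot all_order all_algebra.
From mathcomp Require Import finmap.
From mathcomp Require Import all_classical all_reals all_analysis.
From mathcomp Require Import measurable_realfun ring lra.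
Set Implicit Arguments.
Unset Strict Implicit.
Unset Printing Implicit Defensive.
Import Order.TTheory GRing.Theory Num.Theory.
Import numFieldNormedType.Exports.
Local Open Scope classical_set_scope.
Local Open Scope ring_scope.
Local Open Scope ereal_scope.

(** * Sums against nonnegative weights *)

Section weighted_sums.
Context {R : realType}.

(** Extended-real weights let one notion cover both the coefficients [f n k] and the probabilities
    of events. *)
Definition wsum (w : nat -> \bar R) (h : nat -> R) : \bar R :=
  \sum_(0 <= k <oo) w k * (h k)%:E.

Lemma eq_wsum (w1 w2 : nat -> \bar R) (h1 h2 : nat -> R) :
  w1 =1 w2 -> h1 =1 h2 -> wsum w1 h1 = wsum w2 h2.
Proof. by move=> e1 e2; apply: eq_eseriesr => k _; rewrite e1 e2. Qed.

Lemma wsum_ge0 (w : nat -> \bar R) (h : nat -> R) :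
  (forall k, 0 <= w k) -> (forall k, 0 <= h k)%R -> 0 <= wsum w h.
Proof.
by move=> w0 h0; apply: nneseries_ge0 => k _ _; rewrite mule_ge0// lee_fin.
Qed.

Lemma le_wsum (w : nat -> \bar R) (h1 h2 : nat -> R) :
  (forall k, 0 <= w k) -> (forall k, 0 <= h1 k)%R ->
  (forall k, h1 k <= h2 k)%R -> wsum w h1 <= wsum w h2.
Proof.
move=> w0 h0 h12; apply: lee_nneseries => k _; first by rewrite mule_ge0// lee_fin.
by rewrite lee_wpmul2l// lee_fin.
Qed.

Lemma wsumD (w : nat -> \bar R) (h1 h2 : nat -> R) :
  (forall k, 0 <= w k) -> (forall k, 0 <= h1 k)%R -> (forall k, 0 <= h2 k)%R ->
  wsum w (fun k => h1 k + h2 k)%R = wsum w h1 + wsum w h2.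
Proof.
move=> w0 h10 h20; rewrite -nneseriesD; try by move=> k _ _; rewrite mule_ge0// lee_fin.
by apply: eq_eseriesr => k _; rewrite EFinD ge0_muleDr// lee_fin.
Qed.

Lemma wsumZ (w : nat -> \bar R) (c : R) (h : nat -> R) :
  (forall k, 0 <= w k) -> (forall k, 0 <= h k)%R ->
  wsum w (fun k => c * h k)%R = c%:E * wsum w h.
Proof.
move=> w0 h0; rewrite -nneseriesZl; last by move=> k _; rewrite mule_ge0// lee_fin.
by apply: eq_eseriesr => k _; rewrite EFinM muleCA.
Qed.

Lemma wsum_lin2 (w : nat -> \bar R) (c1 c2 : R) (h1 h2 : nat -> R) :
  (forall k, 0 <= w k) -> (0 <= c1)%R -> (0 <= c2)%R ->
  (forall k, 0 <= h1 k)%R -> (forall k, 0 <= h2 k)%R ->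
  wsum w (fun k => c1 * h1 k + c2 * h2 k)%R =
  c1%:E * wsum w h1 + c2%:E * wsum w h2.
Proof.
by move=> w0 c10 c20 h10 h20; rewrite wsumD ?(wsumZ c1) ?(wsumZ c2)// => k;
  rewrite mulr_ge0.
Qed.

Lemma wsum_lin3 (w : nat -> \bar R) (c1 c2 c3 : R) (h1 h2 h3 : nat -> R) :
  (forall k, 0 <= w k) -> (0 <= c1)%R -> (0 <= c2)%R -> (0 <= c3)%R ->
  (forall k, 0 <= h1 k)%R -> (forall k, 0 <= h2 k)%R -> (forall k, 0 <= h3 k)%R ->
  wsum w (fun k => c1 * h1 k + c2 * h2 k + c3 * h3 k)%R =
  c1%:E * wsum w h1 + c2%:E * wsum w h2 + c3%:E * wsum w h3.
Proof.
move=> w0 c10 c20 c30 h10 h20 h30; rewrite -wsum_lin2// -(wsumZ c3)// -wsumD// => k.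
  by rewrite addr_ge0// mulr_ge0.
by rewrite mulr_ge0.
Qed.

Lemma wsum_fin (w : nat -> \bar R) (h : nat -> R) :
  (forall k, 0 <= w k) -> (forall k, 0 <= h k)%R -> wsum w h < +oo ->
  wsum w h = (fine (wsum w h))%:E.
Proof. by move=> w0 h0 fin; rewrite fineK// ge0_fin_numE// wsum_ge0. Qed.

Lemma wsum_term (w : nat -> \bar R) (h : nat -> R) k :
  (forall k, 0 <= w k) -> (forall k, 0 <= h k)%R -> w k * (h k)%:E <= wsum w h.
Proof.
move=> w0 h0; apply: le_trans (nneseries_lim_ge k.+1 _) => /=.
  by rewrite big_nat_recr//= leeDr// sume_ge0// => i _; rewrite mule_ge0// lee_fin.
by move=> i _ _; rewrite mule_ge0// lee_fin.
Qed.

(* The i-th derivative of s ^ k, so that summing it against a distribution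
   gives the i-th derivative of the generating function. *)
Definition dpow (i : nat) (s : R) (k : nat) : R := ((k ^_ i)%:R * s ^+ (k - i))%R.

Lemma dpow_ge0 i s k : (0 <= s)%R -> (0 <= dpow i s k)%R.
Proof. by move=> s0; rewrite /dpow mulr_ge0// exprn_ge0. Qed.

Lemma dpow0 s k : dpow 0 s k = (s ^+ k)%R.
Proof. by rewrite /dpow ffactn0 subn0 mul1r. Qed.

Lemma dpow1 s k : dpow 1 s k = (k%:R * s ^+ k.-1)%R.
Proof. by rewrite /dpow ffactn1 subn1. Qed.

Lemma dpow2 s k : dpow 2 s k = ((k * k.-1)%:R * s ^+ k.-2)%R.
Proof. by rewrite /dpow ffactnS ffactn1 subn2. Qed.

Lemma dpow_le1 i s k : (0 <= s <= 1)%R -> (dpow i s k <= dpow i 1 k)%R.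
Proof.
by move=> s01; rewrite /dpow expr1n ler_wpM2l// exprn_ile1//; case/andP: s01.
Qed.

(** Here and in the next two lemmas: the Leibniz rule for s^a s^b, at orders 0, 1 and 2. *)
Lemma dpow0D s a b : dpow 0 s (a + b) = (dpow 0 s b * dpow 0 s a)%R.
Proof. by rewrite !dpow0 exprD mulrC. Qed.

Lemma dpow1D s a b :
  dpow 1 s (a + b) = (dpow 0 s b * dpow 1 s a + dpow 1 s b * dpow 0 s a)%R.
Proof.
rewrite !dpow1 !dpow0; case: a b => [|a] [|b]; rewrite ?addn0 ?add0n/=; try by ring.
by rewrite addSn addnS /= -!natr1 natrD !exprS exprD; ring.
Qed.

Lemma dpow2D s a b :
  dpow 2 s (a + b) = (dpow 0 s b * dpow 2 s a + (2 * dpow 1 s b) * dpow 1 s a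
                      + dpow 2 s b * dpow 0 s a)%R.
Proof.
rewrite !dpow1 !dpow0 !dpow2.
case: a b => [|[|a]] [|[|b]]; rewrite ?addn0 ?add0n ?addSn ?addnS /= ?addn0 ?add0n
  ?natrM -?natr1 ?natrD ?exprS ?exprD; by ring.
Qed.

Lemma exprn_tangent_gap (q r : R) k : (0 <= q <= r)%R ->
  (r ^+ k + (r - q) ^+ 2 * (k.-1%:R * r ^+ k.-2) <=
   k%:R * r ^+ k.-1 * (r - q) + q ^+ k)%R.
Proof.
move=> /andP[q0 qr].
case: k => [|k]; first by rewrite /= !expr0; lra.
elim: k => [|k ih]; first by rewrite /= !expr0 !expr1; lra.
have r0 : (0 <= r)%R by exact: le_trans qr.
move/(ler_wpM2l r0): ih => /=.
have hq : (q ^+ k <= r ^+ k)%R by rewrite lerXn2r// nnegrE.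
(* Beyond [r] times the slack of [ih], the slack at the next exponent gains exactly this
   quantity. *)
have : (0 <= (r - q) * q * (r ^+ k - q ^+ k))%R.
  by rewrite !mulr_ge0// subr_ge0.
case: k hq => [|k] hq /=; rewrite !exprS -!natr1 ?expr0; nra.
Qed.

End weighted_sums.

(** * Generating functions of one generation *)

Section one_generation.
Context {R : realType}.
Variable g : nat -> R.
Hypothesis g_ge0 : forall k, (0 <= g k)%R.

Let w (k : nat) : \bar R := (g k)%:E.

Let w_ge0 k : 0 <= w k. Proof. by rewrite lee_fin. Qed.

(** The i-th derivative of the generating function, as a real. Since [fine] turns a divergent series
    into 0, reading it as the series goes through [gderE] and finiteness at 1. *)
Definition gder (i : nat) (s : R) : R := fine (wsum (fun k => (g k)%:E) (dpow i s)).

Lemma gder_ge0 i s : (0 <= s)%R -> (0 <= gder i s)%R.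
Proof. by move=> s0; rewrite fine_ge0// wsum_ge0// => k; exact: dpow_ge0. Qed.

Lemma gderE i s : (0 <= s <= 1)%R -> wsum w (dpow i 1) < +oo ->
  wsum w (dpow i s) = (gder i s)%:E.
Proof.
move=> s01 fin; have /andP[s0 _] := s01.
apply: wsum_fin => //; first by move=> k; exact: dpow_ge0.
apply: le_lt_trans fin; apply: le_wsum => // k; first exact: dpow_ge0.
exact: dpow_le1.
Qed.

Lemma gder0_le1 s : (0 <= s <= 1)%R -> wsum w (dpow 0 1) <= 1 -> (gder 0 s <= 1)%R.
Proof.
move=> s01 le1; have /andP[s0 _] := s01.
rewrite -lee_fin -gderE//; last exact: le_lt_trans (ltry 1).
apply: le_trans le1; apply: le_wsum => // k; first exact: dpow_ge0.
exact: dpow_le1.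
Qed.

Lemma gder0_homo q r : (0 <= q <= r)%R -> (r <= 1)%R -> wsum w (dpow 0 1) < +oo ->
  (gder 0 q <= gder 0 r)%R.
Proof.
move=> /andP[q0 qr] r1 fin; have r0 := le_trans q0 qr.
rewrite -lee_fin -!gderE ?r0 ?q0 ?r1 ?(le_trans qr r1)//.
apply: le_wsum => // k; first exact: dpow_ge0.
by rewrite !dpow0 lerXn2r.
Qed.

(** A positive mean forces [g k > 0] for some k >= 1, and for i <= 1 that single term is already
    positive. *)
Lemma gder_gt0 i s : (0 < s <= 1)%R -> (i <= 1)%N ->
  wsum w (dpow i 1) < +oo -> 0 < wsum w (dpow 1 1) -> (0 < gder i s)%R.
Proof.
move=> /andP[s0 s1] i1 fin mean0.
have [k k0 gk0] : exists2 k, (0 < k)%N & (0 < g k)%R.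
  apply: contrapT => nk; move: mean0; rewrite /wsum eseries0 ?ltxx// => k _ _.
  case: k => [|k]; first by rewrite dpow1 mul0r mule0.
  rewrite /w (_ : g k.+1 = 0)%R ?mul0e//; apply/eqP; rewrite eq_le g_ge0 andbT leNgt.
  by apply/negP => gk; apply: nk; exists k.+1.
rewrite -lte_fin -gderE ?(ltW s0)//.
apply: lt_le_trans (@wsum_term _ w (dpow i s) k _ _) => //; last first.
  by move=> ?; exact: dpow_ge0 (ltW s0).
rewrite mule_gt0// lte_fin// /dpow mulr_gt0 ?exprn_gt0// ltr0n ffact_gt0.
exact: leq_trans i1 k0.
Qed.

Hypothesis mass_le1 : wsum w (dpow 0 1) <= 1.
Hypothesis mean_fin : wsum w (dpow 1 1) < +oo.

Let mass_fin : wsum w (dpow 0 1) < +oo. Proof. exact: le_lt_trans (ltry 1). Qed.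

(* The weights of W are what a chord of the generating function loses against
   its tangent at r, beyond the factor (r - q)^2. *)
Let W r := fine (wsum w (fun k => k.-1%:R * r ^+ k.-2)%R).

Let wsumW r : (0 <= r <= 1)%R ->
  wsum w (fun k => k.-1%:R * r ^+ k.-2)%R = (W r)%:E.
Proof.
move=> /andP[r0 r1]; apply: wsum_fin => //.
  by move=> k; rewrite mulr_ge0// exprn_ge0.
apply: le_lt_trans mean_fin; apply: le_wsum => // k.
  by rewrite mulr_ge0// exprn_ge0.
rewrite dpow1 expr1n ler_pM ?exprn_ge0 ?exprn_ile1// ler_nat.
exact: leq_pred.
Qed.

Let W_ge0 r : (0 <= r)%R -> (0 <= W r)%R.
Proof.
by move=> r0; rewrite fine_ge0// wsum_ge0// => k; rewrite mulr_ge0// exprn_ge0.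
Qed.

(** This is [exprn_tangent_gap] summed against [g], arranged so that all summands are nonnegative
    and the series compare termwise. *)
Lemma gder_tangent q r : (0 <= q <= r)%R -> (r <= 1)%R ->
  (gder 0 r + (r - q) ^+ 2 * W r <= gder 1 r * (r - q) + gder 0 q)%R.
Proof.
move=> /andP[q0 qr] r1; have r0 := le_trans q0 qr.
have q01 : (0 <= q <= 1)%R by rewrite q0 (le_trans qr).
have r01 : (0 <= r <= 1)%R by rewrite r0.
have rq0 : (0 <= r - q)%R by rewrite subr_ge0.
have W0 k : (0 <= k.-1%:R * r ^+ k.-2)%R by rewrite mulr_ge0// exprn_ge0.
rewrite -lee_fin !EFinD [(gder 1 r * _)%R]mulrC (EFinM (_ ^+ 2) (W r))
  (EFinM (r - q) (gder 1 r)).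
rewrite -!gderE// -wsumW// -!wsumZ//; last by move=> k; exact: dpow_ge0.
rewrite -!wsumD//; try by move=> k; rewrite ?dpow_ge0 ?mulr_ge0 ?sqr_ge0 ?exprn_ge0.
apply: le_wsum => // k; first by rewrite addr_ge0 ?dpow_ge0 ?mulr_ge0 ?sqr_ge0 ?exprn_ge0.
rewrite !dpow0 !dpow1 [((r - q) * _)%R]mulrC.
by apply: exprn_tangent_gap; rewrite q0.
Qed.

Let gder_chord q r : (0 <= q <= r)%R -> (r <= 1)%R ->
  (gder 0 r - gder 0 q <= gder 1 r * (r - q))%R.
Proof.
move=> qr r1; have := gder_tangent qr r1; have /andP[q0 qr'] := qr.
have : (0 <= (r - q) ^+ 2 * W r)%R by rewrite mulr_ge0 ?sqr_ge0// W_ge0// (le_trans q0).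
lra.
Qed.

Let sq2 (k : nat) : R := ((2 <= k)%:R * k%:R ^+ 2)%R.
Let id2 (k : nat) : R := ((2 <= k)%:R * k%:R)%R.

Variable c : R.
Hypothesis c_gt0 : (0 < c)%R.
Hypothesis sq_le_mean : wsum w sq2 <= c%:E * wsum w id2.

Let sq2_ge0 k : (0 <= sq2 k)%R. Proof. by rewrite mulr_ge0// sqr_ge0. Qed.

Let id2_ge0 k : (0 <= id2 k)%R. Proof. by rewrite mulr_ge0. Qed.

Let id2_fin : wsum w id2 < +oo.
Proof.
apply: le_lt_trans mean_fin; apply: le_wsum => // k.
by rewrite dpow1 expr1n mulr1 /id2; case: leqP; rewrite ?mul1r ?mul0r.
Qed.

Let sq2_fin : wsum w sq2 < +oo.
Proof.
apply: (le_lt_trans sq_le_mean); rewrite wsum_fin// -EFinM; exact: ltry.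
Qed.

(** The moment hypothesis bounds the sum of squares by the finite mean, and k(k-1) <= k^2. *)
Lemma gder2_fin : wsum w (dpow 2 1) < +oo.
Proof.
apply: le_lt_trans sq2_fin; apply: le_wsum => // k; first exact: dpow_ge0.
rewrite dpow2 expr1n mulr1 /sq2; case: k => [|[|k]]; rewrite /= ?mul0r ?muln0//.
by rewrite mul1r -natrX ler_nat leq_mul.
Qed.

(* Damping the weights by r ^ k preserves the moment inequality with the same
   constant, since [k - c] and [r ^ k - r ^ K] have opposite signs for the
   integer part K of c. *)
Let damped_sq_le_mean r : (0 <= r <= 1)%R ->
  wsum w (fun k => sq2 k * r ^+ k)%R <= c%:E * wsum w (fun k => id2 k * r ^+ k)%R.
Proof.
move=> /andP[r0 r1].
have rX k : (0 <= r ^+ k)%R by exact: exprn_ge0.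
have /andP[Kc cK] := truncn_itv (ltW c_gt0); set K := Num.truncn c in Kc cK.
(* Negative terms are moved across to keep both series nonnegative; once all sums are known to be
   finite, [sq_le_mean] times r^K cancels the extra terms. *)
have le2 : wsum w (fun k => sq2 k * r ^+ k + (c * r ^+ K) * id2 k)%R <=
           wsum w (fun k => c * (id2 k * r ^+ k) + r ^+ K * sq2 k)%R.
  apply: le_wsum => // k; first by rewrite addr_ge0 ?mulr_ge0 ?(ltW c_gt0).
  suff : (id2 k * ((k%:R - c) * (r ^+ k - r ^+ K)) <= 0)%R.
    have -> : sq2 k = (id2 k * k%:R)%R by rewrite /sq2 /id2 expr2 mulrA.
    by nra.
  rewrite mulr_ge0_le0//; have [kK|Kk] := leqP k K.
    rewrite mulr_le0_ge0// ?subr_le0 ?subr_ge0; last exact: ler_wiXn2l.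
    by apply: le_trans Kc; rewrite ler_nat.
  rewrite mulr_ge0_le0// ?subr_le0 ?subr_ge0; last exact: ler_wiXn2l (ltnW Kk).
  by apply: (le_trans (ltW cK)); rewrite ler_nat.
have fin u : (forall k, 0 <= u k)%R -> wsum w u < +oo ->
    wsum w (fun k => u k * r ^+ k)%R = (fine (wsum w (fun k => u k * r ^+ k)%R))%:E.
  move=> u0 ufin; apply: wsum_fin => //; first by move=> k; rewrite mulr_ge0.
  apply: le_lt_trans ufin; apply: le_wsum => // k; first by rewrite mulr_ge0.
  by rewrite ler_piMr// exprn_ile1.
move: le2; rewrite !wsumD ?wsumZ//; try by move=> k; rewrite !mulr_ge0 ?(ltW c_gt0).
move: sq_le_mean; rewrite (fin _ sq2_ge0)// (fin _ id2_ge0)//.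
rewrite (wsum_fin _ sq2_ge0)// (wsum_fin _ id2_ge0)//.
by rewrite -!EFinM -!EFinD !lee_fin => /(ler_wpM2l (rX K)); nra.
Qed.

(** Multiplied by r^2, this is a chain over k >= 2: k(k-1) <= k^2, then the damped moment
    inequality, then k <= 2(k-1). *)
Let gder2_le r : (0 < r <= 1)%R -> (gder 2 r <= 2 * c * W r)%R.
Proof.
move=> /andP[r0 r1]; have r01 : (0 <= r <= 1)%R by rewrite ltW.
have rX k : (0 <= r ^+ k)%R by apply: exprn_ge0; exact: ltW.
have r2 : (0 < r ^+ 2)%R by exact: exprn_gt0.
rewrite -(ler_pM2l r2) -lee_fin.
have -> : (r ^+ 2 * (2 * c * W r) = c * (2 * r ^+ 2 * W r))%R by ring.
rewrite (EFinM _ (gder 2 r)) (EFinM c) (EFinM _ (W r)).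
rewrite -gderE//; last exact: gder2_fin.
have h0 k : (0 <= k.-1%:R * r ^+ k.-2)%R by rewrite mulr_ge0// exprn_ge0// ltW.
have p0 k : (0 <= dpow 2 r k)%R by exact/dpow_ge0/ltW.
rewrite -wsumW// -!wsumZ//; last by move=> k; rewrite mulr_ge0// mulr_ge0// ltW.
apply: (@le_trans _ _ (wsum w (fun k => sq2 k * r ^+ k)%R)).
  apply: le_wsum => // k; first by rewrite mulr_ge0 ?dpow_ge0 ?ltW.
  rewrite dpow2 /sq2; case: k => [|[|k]]; rewrite /= ?mul0r ?muln0 ?mul0r ?mulr0//.
  rewrite mul1r mulrCA -exprD addnC addn2 ler_wpM2r// -natrX ler_nat.
  by rewrite leq_mul.
apply: (le_trans (damped_sq_le_mean r01)).
rewrite -wsumZ//; last by move=> k; rewrite mulr_ge0.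
apply: le_wsum => // k; first by rewrite mulr_ge0 ?(ltW c_gt0)// mulr_ge0.
rewrite ler_wpM2l ?(ltW c_gt0)// /id2; case: k => [|[|k]];
  rewrite /= ?mul0r ?mulr0//.
rewrite mul1r !exprS -!natr1; have := rX k; set x := (r ^+ k)%R => x0.
have : (0 <= r ^+ 2 * x * k%:R)%R by rewrite !mulr_ge0// ltW.
by rewrite expr2; nra.
Qed.

(** Bound the first factor by the chord inequality D <= f'(r)(r-q) and f''(r) by 2c [W r]; the
    resulting (r-q)^2 [W r] is at most the tangent gap f'(r)(r-q) - D. *)
Lemma gder_increment q r : (0 <= q <= r)%R -> (0 < r <= 1)%R ->
  ((gder 0 r - gder 0 q) * gder 2 r * (r - q) <=
   2 * c * (gder 1 r * (gder 1 r * (r - q) - (gder 0 r - gder 0 q))))%R.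
Proof.
move=> qr r01; set D := (gder 0 r - gder 0 q)%R.
have /andP[r0 r1] := r01; have /andP[q0 qr'] := qr.
have F1 : (0 <= gder 1 r)%R by exact/gder_ge0/ltW.
have F2 : (0 <= gder 2 r)%R by exact/gder_ge0/ltW.
have d0 : (0 <= r - q)%R by rewrite subr_ge0.
have tg : (D + (r - q) ^+ 2 * W r <= gder 1 r * (r - q))%R.
  by have := gder_tangent qr r1; rewrite /D; lra.
have D0 : (0 <= D)%R by rewrite subr_ge0; exact: gder0_homo.
have D1 : (D <= gder 1 r * (r - q))%R by exact: gder_chord.
apply: (@le_trans _ _ (gder 1 r * (r - q) * (2 * c * W r) * (r - q))%R).
  by rewrite ler_wpM2r// ler_pM// gder2_le.
have -> : (gder 1 r * (r - q) * (2 * c * W r) * (r - q) =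
  2 * c * (gder 1 r * ((r - q) ^+ 2 * W r)))%R by ring.
rewrite ler_wpM2l ?mulr_ge0 ?(ltW c_gt0)// ler_wpM2l//; lra.
Qed.

(* One backward step of the recursion: a and b stand for the first two
   factorial moments of the generations still to come. *)
Lemma second_moment_step (C q r a b : R) : (2 * c <= C)%R ->
  (0 <= q <= r)%R -> (0 < r <= 1)%R -> (0 <= a)%R -> (0 <= b)%R ->
  ((r - q) * (b + a) <= C * a ^+ 2)%R ->
  ((gder 0 r - gder 0 q) * (gder 2 r * a ^+ 2 + gder 1 r * b + gder 1 r * a) <=
   C * (gder 1 r * a) ^+ 2)%R.
Proof.
move=> cC qr r01 a0 b0 hC; have key := gder_increment qr r01.
have /andP[r0 r1] := r01; have /andP[q0 qr'] := qr.
have F1 : (0 <= gder 1 r)%R by exact/gder_ge0/ltW.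
have F2 : (0 <= gder 2 r)%R by exact/gder_ge0/ltW.
have C0 : (0 <= C)%R by apply: le_trans cC; rewrite mulr_ge0// ltW.
have D1 := gder_chord qr r1.
have D0 : (0 <= gder 0 r - gder 0 q)%R by rewrite subr_ge0; exact: gder0_homo.
move: key D1 D0; move: (gder 1 r) (gder 2 r) (gder 0 r - gder 0 q)%R F1 F2.
move=> f1 f2 D F1 F2 key D1 D0.
(* If q = r, the left side vanishes; otherwise the goal may be multiplied by r - q > 0. *)
have [dq|dq] := eqVneq q r.
  have -> : D = 0%R by move: D1; rewrite dq subrr mulr0; lra.
  by rewrite mul0r mulr_ge0// sqr_ge0.
have d0 : (0 < r - q)%R by rewrite subr_gt0 lt_neqAle dq.
rewrite -(ler_pM2l d0).
(* The f'' part is controlled by [key], the rest by [hC]; when [h1] and [h2] are added, the terms C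
   f1 D a^2 cancel. *)
have h1 : (D * f2 * (r - q) * a ^+ 2 <= C * (f1 * (f1 * (r - q) - D)) * a ^+ 2)%R.
  rewrite ler_wpM2r ?sqr_ge0//; apply: (le_trans key).
  by rewrite ler_wpM2r// mulr_ge0// subr_ge0.
have h2 : (D * f1 * ((r - q) * (b + a)) <= D * f1 * (C * a ^+ 2))%R.
  by rewrite ler_wpM2l// mulr_ge0.
by move: h1 h2; lra.
Qed.

End one_generation.

(** * Independence from offspring variables not yet used *)

Section independence.
Context {d : measure_display} {T : measurableType d} {R : realType}.
Variables (P : probability T R) (X : nat -> nat -> {RV P >-> Ndelta}).

(** Independence of the event [E] from the variables indexed by [D]. Measurability is bundled in so
    that one induction delivers both. *)
Definition indep_from (D : set (nat * nat)) (E : set T) : Prop :=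
  measurable E /\
  forall (J : {fset nat * nat}) (A : nat * nat -> set Ndelta), [set` J] `<=` D ->
    P (E `&` \bigcap_(p in [set` J]) (X p.1 p.2 @^-1` A p)) =
    P E * \prod_(p <- J) P (X p.1 p.2 @^-1` A p).

Lemma measurable_offspring n j (A : set Ndelta) : measurable (X n j @^-1` A).
Proof. by rewrite -[_ @^-1` _]setTI; exact: measurable_funP. Qed.

Lemma indep_from_sub (D D' : set (nat * nat)) (E : set T) :
  D' `<=` D -> indep_from D E -> indep_from D' E.
Proof. by move=> sD [mE iE]; split=> // J A sJ; apply: iE; exact: subset_trans sD. Qed.

Lemma indep_from0 (D : set (nat * nat)) : indep_from D set0.
Proof. by split=> // J A _; rewrite set0I measure0 mul0e. Qed.

(** Observing a fresh variable uses up its index: the hypothesis on [E] is applied to [J] enlarged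
    by (n, j), with [A'] prescribing [B] there. *)
Lemma indep_fromI (D : set (nat * nat)) (E : set T) n j (B : set Ndelta) :
  indep_from D E -> D (n, j) ->
  indep_from (D `\ (n, j)) (E `&` X n j @^-1` B) /\
  P (E `&` X n j @^-1` B) = P E * P (X n j @^-1` B).
Proof.
move=> [mE iE] Dnj.
have PE : P (E `&` X n j @^-1` B) = P E * P (X n j @^-1` B).
  have := iE [fset (n, j)]%fset (fun=> B).
  rewrite set_fset1 bigcap_set1 big_seq_fset1; apply.
  by move=> p ->.
split=> //; split; first exact: measurableI (measurable_offspring _ _ _).
move=> J A sJ; rewrite PE -muleA.
have nJ : (n, j) \notin J by apply/negP => Jnj; have [_] := sJ _ Jnj; apply.
pose A' p := if p == (n, j) then B else A p.
have eA p : p \in J -> A' p = A p.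
  by rewrite /A'; case: eqP => // -> Jnj; rewrite Jnj in nJ.
have -> : \bigcap_(p in [set` J]) (X p.1 p.2 @^-1` A p) =
          \bigcap_(p in [set` J]) (X p.1 p.2 @^-1` A' p).
  by apply: eq_bigcapr => p /= /eA ->.
have -> : \prod_(p <- J) P (X p.1 p.2 @^-1` A p) =
          \prod_(p <- J) P (X p.1 p.2 @^-1` A' p).
  by apply: eq_big_seq => p /eA ->.
have := iE ((n, j) |` J)%fset A'.
rewrite set_fsetU1 bigcap_setU1 big_fsetU1//= {1 3}/A' eqxx setIA; apply.
by move=> p [->|/sJ[]].
Qed.

(** The product over [J] is a finite constant, so it factors out of the series given by countable
    additivity. *)
Lemma indep_from_bigcup (D : set (nat * nat)) (F : nat -> set T) :
  (forall k, indep_from D (F k)) -> trivIset setT F ->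
  indep_from D (\bigcup_k F k) /\ P (\bigcup_k F k) = \sum_(0 <= k <oo) P (F k).
Proof.
move=> iF tF; have mF k : measurable (F k) by case: (iF k).
have PF : P (\bigcup_k F k) = \sum_(0 <= k <oo) P (F k).
  by rewrite measure_semi_bigcup//; exact: bigcup_measurable.
split=> //; split; first exact: bigcup_measurable.
move=> J A sJ; set C := \bigcap_(p in _) _; set c := (\prod_(p <- J) _).
have mC : measurable C.
  apply: fin_bigcap_measurable => // p _; exact: measurable_offspring.
have c_fin : c \is a fin_num.
  apply: prode_fin_num => p _; apply: fin_num_measure; exact: measurable_offspring.
rewrite setI_bigcupl measure_semi_bigcup//; last 3 first.
- by move=> k; exact: measurableI.
- by apply: trivIset_setIr.
- by apply: bigcup_measurable => k _; exact: measurableI.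
rewrite PF muleC -(fineK c_fin) -nneseriesZl//.
by apply: eq_eseriesr => k _; rewrite (fineK c_fin) muleC; case: (iF k) => _; exact.
Qed.

End independence.

(** * Moments of the law of the process *)

(** Fubini for a convolution: for fixed a the terms k < a vanish, and the shift k = a + b leaves the
    average [H a] of h(a + b) over b. *)
Lemma wsum_conv {R : realType} (w : nat -> \bar R) (g h H : nat -> R) :
  (forall k, 0 <= w k) -> (forall k, 0 <= g k)%R -> (forall k, 0 <= h k)%R ->
  (forall a, w a \is a fin_num) ->
  (forall a, wsum (fun k => (g k)%:E) (fun b => h (a + b)%N) = (H a)%:E) ->
  wsum (fun k => \sum_(0 <= a <oo) w a * (if (a <= k)%N then (g (k - a)%N)%:E else 0)) h
  = wsum w H.
Proof.
move=> w0 g0 h0 wfin hH; pose G a k : \bar R := if (a <= k)%N then (g (k - a)%N)%:E else 0.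
have G0 a k : 0 <= G a k by rewrite /G; case: ifP => // _; rewrite lee_fin.
have hG0 a k : 0 <= w a * G a k * (h k)%:E by rewrite !mule_ge0// lee_fin.
transitivity (\sum_(0 <= k <oo) \sum_(0 <= a <oo) w a * G a k * (h k)%:E).
  apply: eq_eseriesr => k _; rewrite muleC -nneseriesZl; last first.
    by move=> a _; exact: mule_ge0 (w0 a) (G0 a k).
  by apply: eq_eseriesr => a _; rewrite muleC.
rewrite nneseries_interchange//; apply: eq_eseriesr => a _.
rewrite -(fineK (wfin a)) -hH -nneseriesZl; last first.
  by move=> b _; rewrite mule_ge0// lee_fin.
have ahG0 k : 0 <= (fine (w a))%:E * G a k * (h k)%:E by rewrite fineK.
rewrite (nneseries_split 0 a)// [X in X + _](_ : _ = 0) ?add0e; last first.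
  apply: big1_seq => k; rewrite mem_index_iota add0n leq0n /= => ka.
  by rewrite /G leqNgt ka mule0 mul0e.
rewrite add0n -nneseries_addn//; apply: eq_eseriesr => b _.
by rewrite /G leq_addl addnK muleA (addnC b).
Qed.

Lemma wsum_mass {R : realType} (g : nat -> R) :
  defective_distr g -> wsum (fun k => (g k)%:E) (dpow 0 1) <= 1.
Proof.
move=> [_]; congr (_ <= _); apply: eq_eseriesr => k _.
by rewrite dpow0 expr1n mule1.
Qed.

Lemma wsum_mean {R : realType} (g : nat -> R) :
  wsum (fun k => (g k)%:E) (dpow 1 1) = gmean g.
Proof. by apply: eq_eseriesr => k _; rewrite dpow1 expr1n mulr1 -EFinM mulrC. Qed.

Lemma addDA : associative addD.
Proof. by move=> [a|] [b|] [c|] //=; rewrite addnA. Qed.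

Lemma add0D : left_id (alive 0) addD.
Proof. by case. Qed.

Lemma addD0 : right_id (alive 0) addD.
Proof. by case=> //= n; rewrite addn0. Qed.

HB.instance Definition _ := Monoid.isLaw.Build Ndelta (alive 0) addD addDA add0D addD0.

Lemma dpow0S {R : realType} (s : R) k : dpow 0 s k.+1 = (s * dpow 0 s k)%R.
Proof. by rewrite !dpow0 exprS. Qed.

Lemma dpow1S {R : realType} (s : R) k :
  dpow 1 s k.+1 = (s * dpow 1 s k + dpow 0 s k)%R.
Proof. by rewrite -[k.+1]addn1 dpow1D (dpow0 s 1) (dpow1 s 1) expr1 expr0 !mul1r. Qed.

Lemma dpow2S {R : realType} (s : R) k :
  dpow 2 s k.+1 = (s * dpow 2 s k + 2 * dpow 1 s k)%R.
Proof.
by rewrite -[k.+1]addn1 dpow2D (dpow0 s 1) (dpow1 s 1) (dpow2 s 1) muln0; ring.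
Qed.

Section law.
Context {d : measure_display} {T : measurableType d} {R : realType}.
Variables (P : probability T R) (f : nat -> nat -> R).
Variable X : nat -> nat -> {RV P >-> Ndelta}.
Hypotheses (hf : varying_env f) (hX : offspring f X).

Definition law (n k : nat) : \bar R := P (dgw X n @^-1` [set alive k]).

Definition litter (n l : nat) (w : T) : Ndelta :=
  \big[addD/alive 0]_(1 <= j < l.+1) X n j w.

Lemma litter0 n w : litter n 0 w = alive 0.
Proof. by rewrite /litter big_geq. Qed.

Lemma litterS n l w : litter n l.+1 w = addD (litter n l w) (X n l.+1 w).
Proof. by rewrite /litter big_nat_recr. Qed.

(** The number l of members that have reproduced is decoupled from the size j of generation n, so
    that one can induct on l and then set l = j. *)
Let ev n j l k : set T := [set w | dgw X n w = alive j /\ litter n.+1 l w = alive k].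

(* The offspring variables not yet used once l members of generation n have
   reproduced. *)
Let future n l : set (nat * nat) :=
  [set p | [/\ (n < p.1)%N, (0 < p.2)%N & (p.1 = n.+1 -> (l < p.2)%N)]].

Let summand a k : set Ndelta := [set x | addD (alive a) x = alive k].

Let P_summand n l a k :
  P (X n.+1 l.+1 @^-1` summand a k) =
  if (a <= k)%N then (f n.+1 (k - a)%N)%:E else 0.
Proof.
case: hX => _ hlaw _; case: leqP => [ak|ka].
  rewrite -(hlaw n.+1 l.+1)//; congr (P (_ @^-1` _)).
  apply/seteqP; split => [[b|]//= [<-]|_ -> /=]; first by rewrite addKn.
  by congr Some; rewrite subnKC.
rewrite (_ : summand a k = set0) ?preimage_set0 ?measure0//.
by apply/seteqP; split => // -[b|]//= [abk]; move: ka; rewrite -abk ltnNge leq_addr.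
Qed.

Let evS n j l k :
  ev n j l.+1 k = \bigcup_a (ev n j l a `&` X n.+1 l.+1 @^-1` summand a k).
Proof.
apply/seteqP; split => w /=.
  move=> [Zj]; rewrite litterS; case E : (litter n.+1 l w) => [a|//] ak.
  by exists a => //=; split.
by move=> [a _ /= [[Zj E] ak]]; split => //; rewrite litterS E.
Qed.

(** Split by the partial litter a: the next offspring variable is still in [future n l], so
    probabilities multiply and the sum over a is a convolution. *)
Let ev_step n j l : (forall k, indep_from X (future n l) (ev n j l k)) ->
  forall k, indep_from X (future n l.+1) (ev n j l.+1 k) /\
    P (ev n j l.+1 k) = \sum_(0 <= a <oo) P (ev n j l a) *
      (if (a <= k)%N then (f n.+1 (k - a)%N)%:E else 0).
Proof.
move=> ih k; rewrite evS.
have ihI a := indep_fromI (n := n.+1) (j := l.+1) (summand a k) (ih a).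
have [|//|iU ->] := @indep_from_bigcup _ _ _ P X (future n l.+1)
    (fun a => ev n j l a `&` X n.+1 l.+1 @^-1` summand a k).
- move=> a; apply: indep_from_sub (ihI a _).1 => //.
  move=> [p1 p2] /= [np p0 pl]; split; first by split => // /pl/ltnW.
  by case=> e1 e2; move: (pl e1); rewrite e2 ltnn.
- apply/trivIsetP => a b _ _ ab; apply/seteqP; split => // w /= [[[_ Ea] _] [[_ Eb] _]].
  by move: Eb ab; rewrite Ea => -[->]; rewrite eqxx.
split => //; apply: eq_eseriesr => a _.
by rewrite (ihI a _).2// P_summand.
Qed.

Let ev0 n j k : ev n j 0 k = if k == 0%N then dgw X n @^-1` [set alive j] else set0.
Proof.
apply/seteqP; split => w; rewrite /ev /= litter0.
  by move=> [Zj [<-]].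
by case: eqP => // ->.
Qed.

Let ev_indep n j l k : (forall j, indep_from X (future n 0) (dgw X n @^-1` [set alive j])) ->
  indep_from X (future n l) (ev n j l k).
Proof.
move=> ih; elim: l k => [|l IH] k; last by case: (ev_step IH k).
by rewrite ev0; case: eqP => // _; exact: indep_from0.
Qed.

Let dgwS n k : dgw X n.+1 @^-1` [set alive k] = \bigcup_j ev n j j k.
Proof.
apply/seteqP; split => w /=.
  by case E : (dgw X n w) => [j|//] /= jk; exists j.
by move=> [j _ /= [-> /= jk]].
Qed.

Let ev_triv n k : trivIset setT (fun j => ev n j j k).
Proof.
apply/trivIsetP => a b _ _ ab; apply/seteqP; split => // w /= [[Ea _] [Eb _]].
by move: Eb ab; rewrite Ea => -[->]; rewrite eqxx.
Qed.

Let dgw_indep n k : indep_from X (future n 0) (dgw X n @^-1` [set alive k]).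
Proof.
elim: n k => [|n IH] k.
  have -> : dgw X 0 @^-1` [set alive k] = if k == 1%N then setT else set0.
    apply/seteqP; split => w /=; first by case=> <-.
    by case: eqP => // ->.
  case: eqP => _; last exact: indep_from0.
  split=> // J A sJ; rewrite setTI probability_setT mul1e.
  case: hX => iX _ _; apply: iX => [p /sJ [p1 p2 _]//|p].
  by [].
rewrite dgwS; apply: (indep_from_bigcup (D := future n.+1 0) _ (@ev_triv n k)).1 => j.
(* Variables of generations beyond n + 1 lie in [future n j] for every j, so one index set serves
   the whole union over j. *)
apply: indep_from_sub (ev_indep j j k IH) => -[p1 p2] /= [np p0 pl].
by split => //; [exact: ltnW|move=> e1; rewrite e1 ltnn in np].
Qed.

Lemma measurable_law n k : measurable (dgw X n @^-1` [set alive k]).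
Proof. by case: (dgw_indep n k). Qed.

Lemma law_ge0 n k : 0 <= law n k.
Proof. exact: measure_ge0. Qed.

Let evP_ge0 n j l k : 0 <= P (ev n j l k).
Proof. exact: measure_ge0. Qed.

Let offspring_ge0 n k : (0 <= f n.+1 k)%R.
Proof. by have [[+ _] _] := hf (ltn0Sn n). Qed.

Let offspringE_ge0 n k : 0 <= (f n.+1 k)%:E.
Proof. by rewrite lee_fin. Qed.

Let lawS n k : law n.+1 k = \sum_(0 <= j <oo) P (ev n j j k).
Proof.
rewrite /law dgwS; apply: (indep_from_bigcup (D := set0) _ (@ev_triv n k)).2 => j.
exact: indep_from_sub (ev_indep j j k (dgw_indep n)).
Qed.

Let wsum_ev0 n j (h : nat -> R) : (forall k, 0 <= h k)%R ->
  wsum (fun k => P (ev n j 0 k)) h = law n j * (h 0%N)%:E.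
Proof.
move=> h0; rewrite /wsum nneseries_recl//; last by move=> k _; rewrite mule_ge0// lee_fin.
rewrite ev0 eqxx eseries0 ?adde0// => k k0 _.
by rewrite ev0 gtn_eqF// measure0 mul0e.
Qed.

(** One more reproduction replaces the test function h by its average H over the offspring
    distribution. *)
Let wsum_evS n j l (h H : nat -> R) : (forall k, 0 <= h k)%R ->
  (forall a, wsum (fun k => (f n.+1 k)%:E) (fun b => h (a + b)%N) = (H a)%:E) ->
  wsum (fun k => P (ev n j l.+1 k)) h = wsum (fun k => P (ev n j l k)) H.
Proof.
move=> h0 hH; rewrite -[RHS](@wsum_conv _ _ (f n.+1) h)//; last first.
  by move=> a; rewrite /= fin_num_measure//; case: (ev_indep j l a (dgw_indep n)).
apply: eq_wsum => // k.
by have [_ ->] := ev_step (fun k => ev_indep j l k (dgw_indep n)) k.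
Qed.

Let wsum_lawS n (h H : nat -> R) : (forall k, 0 <= h k)%R ->
  (forall j, wsum (fun k => P (ev n j j k)) h = law n j * (H j)%:E) ->
  wsum (law n.+1) h = wsum (law n) H.
Proof.
move=> h0 hH.
transitivity (\sum_(0 <= k <oo) \sum_(0 <= j <oo) P (ev n j j k) * (h k)%:E).
  apply: eq_eseriesr => k _; rewrite lawS muleC -nneseriesZl//.
  by apply: eq_eseriesr => j _; rewrite muleC.
rewrite nneseries_interchange; last by move=> k j; rewrite mule_ge0// lee_fin.
by apply: eq_eseriesr => j _; exact: hH.
Qed.

Let g n i s := gder (f n.+1) i s.

Let mass_le1 n : wsum (fun k => (f n.+1 k)%:E) (dpow 0 1) <= 1.
Proof. by apply: wsum_mass; case: (hf (ltn0Sn n)). Qed.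

Let mass_fin n : wsum (fun k => (f n.+1 k)%:E) (dpow 0 1) < +oo.
Proof. exact: le_lt_trans (ltry 1). Qed.

Let mean_fin n : wsum (fun k => (f n.+1 k)%:E) (dpow 1 1) < +oo.
Proof.
by rewrite wsum_mean; have [_ []] := hf (ltn0Sn n).
Qed.

Let gE n i s : (0 <= s <= 1)%R ->
  wsum (fun k => (f n.+1 k)%:E) (dpow i 1) < +oo ->
  wsum (fun k => (f n.+1 k)%:E) (dpow i s) = (g n i s)%:E.
Proof. exact: gderE. Qed.

Let lawE n k : law n k = (fine (law n k))%:E.
Proof. by rewrite fineK// fin_num_measure//; exact: measurable_law. Qed.

(** The litter of l members has generating function g(s)^l. This and the next two lemmas give that
    identity and its first two derivatives in s; induction on l with the Leibniz rule avoids
    differentiating series. *)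
Let wsum_ev_dpow0 n j l s : (0 <= s <= 1)%R ->
  wsum (fun k => P (ev n j l k)) (dpow 0 s) = law n j * (dpow 0 (g n 0 s) l)%:E.
Proof.
move=> s01; have /andP[s0 _] := s01; have p0 k := dpow_ge0 0 k s0.
elim: l => [|l ih]; first by rewrite wsum_ev0// !dpow0.
rewrite (@wsum_evS _ _ _ _ (fun a => g n 0 s * dpow 0 s a)%R)//; last first.
  move=> a; rewrite mulrC EFinM -gE// -wsumZ//.
  by apply: eq_wsum => // b; rewrite dpow0D mulrC.
rewrite wsumZ// ih dpow0S lawE -!EFinM; congr EFin; ring.
Qed.

Let wsum_ev_dpow1 n j l s : (0 <= s <= 1)%R ->
  wsum (fun k => P (ev n j l k)) (dpow 1 s) =
  law n j * (g n 1 s * dpow 1 (g n 0 s) l)%:E.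
Proof.
move=> s01; have /andP[s0 _] := s01.
have p0 i k := dpow_ge0 i k s0.
have g0 i : (0 <= g n i s)%R := gder_ge0 (offspring_ge0 n) i s0.
elim: l => [|l ih]; first by rewrite wsum_ev0// !dpow1 !mul0r mulr0.
rewrite (@wsum_evS _ _ _ _ (fun a => g n 0 s * dpow 1 s a + g n 1 s * dpow 0 s a)%R)//.
  rewrite wsum_lin2// ih wsum_ev_dpow0// dpow1S lawE -!EFinM -EFinD; congr EFin; ring.
move=> a; transitivity (wsum (fun k => (f n.+1 k)%:E)
    (fun b => dpow 1 s a * dpow 0 s b + dpow 0 s a * dpow 1 s b)%R).
  by apply: eq_wsum => // b; rewrite dpow1D; ring.
by rewrite wsum_lin2// (gE (i := 0))// (gE (i := 1))// -!EFinM -EFinD; congr EFin; ring.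
Qed.

Let wsum_ev_dpow2 n j l s : (0 <= s <= 1)%R ->
  wsum (fun k => (f n.+1 k)%:E) (dpow 2 1) < +oo ->
  wsum (fun k => P (ev n j l k)) (dpow 2 s) =
  law n j * (g n 1 s ^+ 2 * dpow 2 (g n 0 s) l + g n 2 s * dpow 1 (g n 0 s) l)%:E.
Proof.
move=> s01 fin2; have /andP[s0 _] := s01.
have p0 i k := dpow_ge0 i k s0.
have g0 i : (0 <= g n i s)%R := gder_ge0 (offspring_ge0 n) i s0.
elim: l => [|l ih]; first by rewrite wsum_ev0// !dpow2 !dpow1 !mul0r !mulr0 addr0.
rewrite (@wsum_evS _ _ _ _ (fun a => g n 0 s * dpow 2 s a +
    (2 * g n 1 s) * dpow 1 s a + g n 2 s * dpow 0 s a)%R)//.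
  rewrite wsum_lin3 ?mulr_ge0// ih wsum_ev_dpow1// wsum_ev_dpow0// dpow2S dpow1S lawE
    -!EFinM -!EFinD.
  congr EFin; ring.
move=> a; transitivity (wsum (fun k => (f n.+1 k)%:E)
    (fun b => dpow 2 s a * dpow 0 s b + (2 * dpow 1 s a) * dpow 1 s b +
              dpow 0 s a * dpow 2 s b)%R).
  by apply: eq_wsum => // b; rewrite dpow2D; ring.
have c1 : (0 <= 2 * dpow 1 s a)%R by rewrite mulr_ge0.
by rewrite wsum_lin3// (gE (i := 0))// (gE (i := 1))// (gE (i := 2))//
  -!EFinM -!EFinD; congr EFin; ring.
Qed.

(** Writing F_n for the generating function of Z_n, this is F_(n+1)(s) = F_n(f_(n+1)(s)); the next
    two lemmas are the chain rule for its first and second derivatives. *)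
Lemma law_dpow0 n s : (0 <= s <= 1)%R ->
  wsum (law n.+1) (dpow 0 s) = wsum (law n) (dpow 0 (gder (f n.+1) 0 s)).
Proof.
move=> s01; have /andP[s0 _] := s01.
by apply: wsum_lawS => [k|j]; [exact: dpow_ge0|exact: wsum_ev_dpow0].
Qed.

Lemma law_dpow1 n s : (0 <= s <= 1)%R ->
  wsum (law n.+1) (dpow 1 s) =
  (gder (f n.+1) 1 s)%:E * wsum (law n) (dpow 1 (gder (f n.+1) 0 s)).
Proof.
move=> s01; have /andP[s0 _] := s01.
have g0 i : (0 <= g n i s)%R := gder_ge0 (offspring_ge0 n) i s0.
rewrite -wsumZ; [|by move=> k; exact: law_ge0|by move=> k; exact: dpow_ge0 (g0 0%N)].
by apply: wsum_lawS => [k|j]; [exact: dpow_ge0|exact: wsum_ev_dpow1].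
Qed.

Lemma law_dpow2 n s : (0 <= s <= 1)%R ->
  wsum (fun k => (f n.+1 k)%:E) (dpow 2 1) < +oo ->
  wsum (law n.+1) (dpow 2 s) =
  (gder (f n.+1) 1 s ^+ 2)%:E * wsum (law n) (dpow 2 (gder (f n.+1) 0 s)) +
  (gder (f n.+1) 2 s)%:E * wsum (law n) (dpow 1 (gder (f n.+1) 0 s)).
Proof.
move=> s01 fin2; have /andP[s0 _] := s01.
have g0 i : (0 <= g n i s)%R := gder_ge0 (offspring_ge0 n) i s0.
have p0 i k := dpow_ge0 i k (g0 0%N).
rewrite -wsum_lin2 ?sqr_ge0//; last exact: g0.
by apply: wsum_lawS => [k|j]; [exact: dpow_ge0|exact: wsum_ev_dpow2].
Qed.

End law.

(** * Survival and moments *)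

Lemma dgw_absorb {d : measure_display} {T : measurableType d} {R : realType}
    (P : probability T R) (X : nat -> nat -> {RV P >-> Ndelta}) (a : Ndelta) m n w :
  a = alive 0 \/ a = Delta -> (m <= n)%N -> dgw X m w = a -> dgw X n w = a.
Proof.
move=> ha mn Zm; rewrite -(subnK mn); elim: (n - m)%N => [//|l ih].
by rewrite addSn /= ih; case: ha => ->//=; rewrite big_geq.
Qed.

Lemma survival_set {d : measure_display} {T : measurableType d} {R : realType}
    (P : probability T R) (X : nat -> nat -> {RV P >-> Ndelta}) n :
  [set w | n%:R%:E < tau_a (dgw X) w :> \bar R] =
  \bigcup_k (dgw X n @^-1` [set alive k.+1]).
Proof.
apply/seteqP; split => w /=.
  rewrite /tau_a lt_min => /andP[n0 nD].
  (* Hitting times start at generation 1, so n = 0 is separate; there Z_0 = 1 is the witness. *)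
  case: n n0 nD => [|n] n0 nD; first by exists 0%N.
  have hit a : (n.+1%:R%:E < hitting_time ((dgw X)^~ w) a :> \bar R) ->
      dgw X n.+1 w <> a.
    move=> + Za; apply/negP; rewrite -leNgt; apply: ereal_inf_lbound.
    by exists n.+1.
  case E : (dgw X n.+1 w) => [[|k]|]; first by have := hit _ n0 E.
    by exists k.
  by have := hit _ nD E.
move=> [k _ /= Zn]; rewrite /tau_a lt_min.
suff hit a : a = alive 0 \/ a = Delta ->
    (n%:R%:E < hitting_time ((dgw X)^~ w) a :> \bar R).
  by rewrite !hit//; [right|left].
(* A visit to an absorbing state at some m <= n would persist to time n, where the state is
   positive; hence the hitting time is at least n + 1. *)
move=> ha; apply: (@lt_le_trans _ _ n.+1%:R%:E); first by rewrite lte_fin ltr_nat.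
apply: le_ereal_inf_tmp => _ [m [m0 Zm] <-]; rewrite lee_fin ler_nat ltnNge.
apply/negP => mn; have := dgw_absorb ha mn Zm; rewrite Zn.
by case: ha => ->.
Qed.

(** The domain of integration is a countable disjoint union of fibres of [Y], and the integrand is
    constant on each. *)
Lemma expectDE {d : measure_display} {T : measurableType d} {R : realType}
    (P : probability T R) (h : nat -> R) (Y : T -> Ndelta) (A : set nat) :
  (forall k, measurable (Y @^-1` [set alive k])) -> (forall k, 0 <= h k)%R ->
  expectD P h Y A =
  wsum (fun k => P (Y @^-1` [set alive k])) (fun k => (k \in A)%:R * h k)%R.
Proof.
move=> mY h0; pose F k := if k \in A then Y @^-1` [set alive k] else set0.
have mF k : measurable (F k) by rewrite /F; case: ifP.
have YF k w : F k w -> Y w = alive k by rewrite /F; case: ifP => //.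
have -> : expectD P h Y A = \int[P]_(w in \bigcup_k F k) (oapp h 0%R (Y w))%:E.
  congr integral; apply/seteqP; split => w /=.
    by move=> [k Ak Yk]; exists k => //; rewrite /F mem_set//.
  move=> [k _]; rewrite /F; case: ifPn => // /set_mem Ak /= Yk.
  by exists k.
rewrite ge0_integral_bigcup//; last 3 first.
- apply/measurable_fun_bigcup => // k.
  apply: (eq_measurable_fun (cst (h k)%:E)) => // w /set_mem /YF /= ->.
  by [].
- by move=> w _; rewrite lee_fin; case: (Y w) => /=.
- apply/trivIsetP => a b _ _ ab; apply/seteqP; split => // w [/YF Ea /YF Eb].
  by move: Eb ab; rewrite Ea => -[->]; rewrite eqxx.
apply: eq_eseriesr => k _.
rewrite (eq_integral (cst (h k)%:E)); last by move=> w /set_mem /YF ->.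
rewrite integral_cst// /F muleC; case: ifP; rewrite ?mul1r ?mul0r//.
by rewrite measure0 mul0e mule0.
Qed.

Section moments.
Context {d : measure_display} {T : measurableType d} {R : realType}.
Variables (P : probability T R) (f : nat -> nat -> R).
Variable X : nat -> nat -> {RV P >-> Ndelta}.
Hypotheses (hf : varying_env f) (hX : offspring f X).

Let law_ge0 n k : 0 <= law X n k.
Proof. exact: measure_ge0. Qed.

Lemma wsum_law0 (h : nat -> R) : (forall k, 0 <= h k)%R ->
  wsum (law X 0) h = (h 1%N)%:E.
Proof.
move=> h0; have lawn1 k : k != 1%N -> law X 0 k = 0.
  move=> k1; rewrite /law (_ : _ @^-1` _ = set0) ?measure0//.
  by apply/seteqP; split => // w /= [k1']; rewrite -k1' eqxx in k1.
rewrite /wsum (nneseries_split 0 2) => [|k _]; last by rewrite mule_ge0// lee_fin.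
rewrite eseries0 ?adde0 => [|k k2 _]; last by rewrite lawn1 ?mul0e// gtn_eqF.
rewrite !big_nat_recr//= big_geq// add0e lawn1// mul0e add0e.
rewrite /law (_ : _ @^-1` _ = setT) ?probability_setT ?mul1e//.
by apply/seteqP; split.
Qed.

Lemma survivalE n :
  P [set w | n%:R%:E < tau_a (dgw X) w :> \bar R] =
  wsum (law X n) (fun k => (0 < k)%:R)%R.
Proof.
rewrite survival_set measure_semi_bigcup//; first last.
- by apply: bigcup_measurable => k _; exact: measurable_law hX n _.
- apply/trivIsetP => a b _ _ ab; apply/seteqP; split => // w /= [-> [E]].
  by rewrite E eqxx in ab.
- by move=> k; exact: measurable_law hX n _.
have h0 k : 0 <= law X n k * ((0 < k)%:R : R)%:E by rewrite mule_ge0// lee_fin.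
rewrite /wsum [RHS]nneseries_recl//= mule0 add0e -(nneseries_addn 1)//.
by apply: eq_eseriesr => k _; rewrite addn1 mule1.
Qed.

Lemma mean_le_mu n : wsum (law X n) (dpow 1 1) <= mu f n.
Proof.
elim: n => [|n ih].
  rewrite wsum_law0; last by move=> k; exact: dpow_ge0.
  by rewrite dpow1 expr1n mulr1 /mu big_geq.
have [df [mean0 meany]] := hf (ltn0Sn n); have [f0 _] := df.
have mass1 := wsum_mass df.
have u01 : (0 <= (1 : R) <= 1)%R by rewrite ler01 lexx.
rewrite (law_dpow1 hf hX)// -gderE ?wsum_mean//.
rewrite /mu big_nat_recr//= muleC lee_wpmul2r ?(ltW mean0)//.
apply: le_trans ih; apply: le_wsum => // k.
  by apply: dpow_ge0; exact: gder_ge0.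
(* Defectiveness enters here: the derivative is evaluated at f_(n+1)(1), which may be below 1, and
   it is at most its value at 1. *)
by apply: dpow_le1; rewrite gder_ge0// gder0_le1.
Qed.

End moments.

(** * Survival against the second moment, under the moment hypothesis *)

Section second_moment.
Context {d : measure_display} {T : measurableType d} {R : realType}.
Variables (P : probability T R) (f : nat -> nat -> R).
Variable X : nat -> nat -> {RV P >-> Ndelta}.
Hypotheses (hf : varying_env f) (hX : offspring f X).
Variable c : R.
Hypothesis c_gt0 : (0 < c)%R.
Hypothesis hc : forall n, (0 < n)%N ->
  wsum (fun k => (f n k)%:E) (fun k => (2 <= k)%:R * k%:R ^+ 2)%R <=
  c%:E * wsum (fun k => (f n k)%:E) (fun k => (2 <= k)%:R * k%:R)%R.

(** The 1 serves the start of the backward recursion, the 2c its inductive step. *)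
Let C : R := Num.max 1%R (2 * c)%R.

(* Read backwards from generation n, the first two factorial moments of Z_n are
   combinations of those of Z_i damped by r, the probability that a family
   founded in generation i avoids the graveyard; q is the probability that it
   dies out. *)
Let backward_recursion l i : exists r q a b : R,
  [/\ (0 <= q <= r)%R, (0 < r <= 1)%R, (0 < a)%R, (0 <= b)%R &
      ((r - q) * (b + a) <= C * a ^+ 2)%R] /\
  [/\ wsum (law X (l + i)) (dpow 0 1) = wsum (law X i) (dpow 0 r),
      wsum (law X (l + i)) (dpow 0 0) = wsum (law X i) (dpow 0 q),
      wsum (law X (l + i)) (dpow 1 1) = a%:E * wsum (law X i) (dpow 1 r) &
      wsum (law X (l + i)) (dpow 2 1) =
      (a ^+ 2)%:E * wsum (law X i) (dpow 2 r) + b%:E * wsum (law X i) (dpow 1 r)].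
Proof.
elim: l i => [|l ih] i.
  (* At generation n itself the family is its single founder: not in the graveyard, not extinct,
     with factorial moments 1 and 0. *)
  exists 1%R, 0%R, 1%R, 0%R; split; split; rewrite ?ler01 ?ltr01 ?lexx//.
  - by rewrite subr0 add0r mulr1 expr1n mulr1 le_max lexx.
  - by rewrite mul1e.
  - by rewrite expr1n mul1e mul0e adde0.
rewrite addSnnS; have [r [q [a [b [[qr r01 a0 b0 hC] [e0r e0q e1 e2]]]]]] := ih i.+1.
have [df [mean0 meany]] := hf (ltn0Sn i); have [f0 _] := df.
have mass1 := wsum_mass df.
have massy : wsum (fun k => (f i.+1 k)%:E) (dpow 0 1) < +oo.
  exact: le_lt_trans (ltry 1).
rewrite -wsum_mean in mean0 meany.
have fin2 := gder2_fin f0 meany (hc (ltn0Sn i)).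
have /andP[q0 qr'] := qr; have /andP[r0 r1] := r01.
have r01' : (0 <= r <= 1)%R by rewrite ltW.
have q01 : (0 <= q <= 1)%R by rewrite q0 (le_trans qr').
have F0 k := gder_ge0 f0 k (ltW r0); have a0' := ltW a0.
have F1 : (0 < gder (f i.+1) 1 r)%R by exact: gder_gt0.
exists (gder (f i.+1) 0 r), (gder (f i.+1) 0 q), (gder (f i.+1) 1 r * a)%R,
  (gder (f i.+1) 2 r * a ^+ 2 + gder (f i.+1) 1 r * b)%R; split; split.
- by rewrite gder_ge0//= gder0_homo.
- by rewrite gder_gt0//= gder0_le1.
- exact: mulr_gt0.
- by rewrite addr_ge0// mulr_ge0// sqr_ge0.
- have cC : (2 * c <= C)%R by rewrite le_max lexx orbT.
  exact: (second_moment_step f0 mass1 meany c_gt0 (hc (ltn0Sn i)) cC qr r01 (ltW a0)).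
- by rewrite e0r (law_dpow0 hf hX).
- by rewrite e0q (law_dpow0 hf hX).
- by rewrite e1 (law_dpow1 hf hX)// muleA -EFinM mulrC.
- rewrite e2 (law_dpow2 hf hX)// (law_dpow1 hf hX)// ge0_muleDr; last 2 first.
  + by rewrite mule_ge0 ?lee_fin ?sqr_ge0// wsum_ge0// => k; exact/dpow_ge0.
  + by rewrite mule_ge0 ?lee_fin// wsum_ge0// => k; exact/dpow_ge0.
  rewrite !muleA -!EFinM -addeA -ge0_muleDl ?lee_fin ?mulr_ge0 ?sqr_ge0//.
  by rewrite -EFinD; congr (_%:E * _ + _%:E * _); ring.
Qed.

(** At i = 0 the recursion is evaluated at Z_0 = 1, so r - q is the survival probability, a the mean
    and b + a the second moment. *)
Lemma survival_moments n : exists s a m : R,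
  [/\ wsum (law X n) (fun k => (0 < k)%:R)%R = s%:E,
      wsum (law X n) (fun k => k%:R)%R = a%:E,
      wsum (law X n) (fun k => k%:R ^+ 2)%R = m%:E &
      [/\ (0 < m)%R, (a ^+ 2 <= s * m)%R & (s * m <= C * a ^+ 2)%R]].
Proof.
have law0 k : 0 <= law X n k by exact: measure_ge0.
have [r [q [a [b [[/andP[q0 qr] /andP[r0 r1] a0 b0 hC]]]]]] := backward_recursion n 0.
rewrite addn0 !wsum_law0 => [|*|*|*|*]; try by rewrite dpow_ge0// ltW.
rewrite !dpow0 dpow1 dpow2 /= !expr0 !mulr1 !expr1.
rewrite !mule1 mule0 add0e => -[e0r e0q e1 e2].
(* Survival is F_n(1) - F_n(0): since 0^0 = 1, [dpow 0 0] is the indicator of k = 0. *)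
have es : wsum (law X n) (fun k => (0 < k)%:R)%R = (r - q)%:E.
  have : wsum (law X n) (dpow 0 1) =
      wsum (law X n) (fun k => (0 < k)%:R)%R + wsum (law X n) (dpow 0 0).
    rewrite -wsumD//; last by move=> k; exact: dpow_ge0.
    apply: eq_wsum => // k; rewrite !dpow0 expr1n expr0n.
    by case: k => [|k]; rewrite ?add0r ?addr0.
  rewrite e0r e0q EFinB => ->; rewrite addeK//.
have ea : wsum (law X n) (fun k => k%:R)%R = a%:E.
  by rewrite -e1; apply: eq_wsum => // k; rewrite dpow1 expr1n mulr1.
have em : wsum (law X n) (fun k => k%:R ^+ 2)%R = (b + a)%:E.
  rewrite EFinD -e1 -e2 -wsumD//; try by move=> k; exact: dpow_ge0.
  apply: eq_wsum => // k; rewrite dpow2 dpow1 !expr1n !mulr1.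
  by case: k => [|k]; rewrite ?expr2 ?mul0r ?addr0//= natrM -natr1; ring.
exists (r - q)%R, a, (b + a)%R; split => //.
have m0 : (0 < b + a)%R by rewrite ltr_wpDl.
split=> //.
(* Cauchy-Schwarz, from (a k - m)^2 >= 0 for k > 0. *)
set m := (b + a)%R in em m0 *.
have : wsum (law X n) (fun k => (2 * m * a) * k%:R)%R <=
       wsum (law X n) (fun k => a ^+ 2 * k%:R ^+ 2 + m ^+ 2 * (0 < k)%:R)%R.
  apply: le_wsum => // k; first by rewrite !mulr_ge0// ltW.
  case: k => [|k]; first by rewrite /= expr0n /= !mulr0 addr0.
  rewrite /= mulr1; have := sqr_ge0 (a * k.+1%:R - m)%R; set x := k.+1%:R.
  by rewrite !expr2; lra.
rewrite wsumZ// wsum_lin2 ?sqr_ge0//.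
rewrite ea em es -!EFinM -EFinD lee_fin => h.
by rewrite -(ler_pM2l m0); move: h; rewrite !expr2; lra.
Qed.

End second_moment.

Theorem proposition1 (d : measure_display) (T : measurableType d)
    (R : realType) (P : probability T R) (f : nat -> nat -> R)
    (X : nat -> nat -> {RV P >-> Ndelta})
    (hf : varying_env f) (hX : offspring f X) :
  let Z := dgw X in
  let survival n := P [set w | n%:R%:E < tau_a Z w :> \bar R] in
  let ratio n := expectD P (fun k => k%:R)%R (Z n) setT ^+ 2 /
                 expectD P (fun k => k%:R ^+ 2)%R (Z n) setT in
  (forall n, (0 < n)%N ->
     survival n <= ereal_inf [set mu f i | i in [set i | (i <= n)%N]]) /\
  ((exists c : R, (0 < c)%R /\ forall n, (0 < n)%N ->
      expectD P (fun k => k%:R ^+ 2)%R (X n 1%N) [set k | (2 <= k)%N] <=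
      c%:E * expectD P (fun k => k%:R)%R (X n 1%N) [set k | (2 <= k)%N]) ->
   exists c' : R, (0 < c')%R /\
     \forall n \near \oo, ratio n <= survival n <= c'%:E * ratio n).
Proof.
move=> Z survival ratio.
have mZ n k : measurable (Z n @^-1` [set alive k]) by exact: measurable_law hX n k.
have law0 n k : 0 <= law X n k by exact: measure_ge0.
have hE n (h : nat -> R) : (forall k, 0 <= h k)%R ->
    expectD P h (Z n) setT = wsum (law X n) h.
  move=> h0; rewrite expectDE//; apply: eq_wsum => // k.
  by rewrite mem_set// mul1r.
have survE n : survival n = wsum (law X n) (fun k => (0 < k)%:R)%R.
  exact: survivalE hX n.
split=> [n _|[c [c0 hc]]].
  apply: le_ereal_inf_tmp => _ [i /= le_in <-].
  apply: (@le_trans _ _ (survival i)).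
    apply: le_measure; rewrite ?inE /=; try (rewrite survival_set;
      by apply: bigcup_measurable => k _; exact: mZ).
    by move=> w; apply: le_lt_trans; rewrite lee_fin ler_nat.
  apply: le_trans (mean_le_mu hf hX i); rewrite survE; apply: le_wsum => // k.
  by rewrite dpow1 expr1n mulr1 ler_nat; case: k.
have hXE n (h : nat -> R) : (0 < n)%N -> (forall k, 0 <= h k)%R ->
    expectD P h (X n 1%N) [set k | (2 <= k)%N] =
    wsum (fun k => (f n k)%:E) (fun k => (2 <= k)%:R * h k)%R.
  move=> n0 h0; rewrite expectDE//; last first.
    by move=> k; exact: measurable_offspring.
  case: hX => _ hlaw _; apply: eq_wsum => k; first exact: hlaw.
  by congr ((nat_of_bool _)%:R * _)%R; apply/idP/idP; rewrite inE.
have hc' n : (0 < n)%N ->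
    wsum (fun k => (f n k)%:E) (fun k => (2 <= k)%:R * k%:R ^+ 2)%R <=
    c%:E * wsum (fun k => (f n k)%:E) (fun k => (2 <= k)%:R * k%:R)%R.
  move=> n0; have := hc n n0; rewrite !hXE// => k; exact: sqr_ge0.
(* This is the constant of the backward recursion; with it both bounds hold at every n. *)
exists (Num.max 1 (2 * c))%R; split; first by rewrite lt_max ltr01.
apply: nearW => n.
have [s [a [m [es ea em [m0 low up]]]]] := survival_moments hf hX c0 hc' n.
have -> : ratio n = (a ^+ 2 / m)%:E.
  (* Since m > 0, the extended-real inverse is the real one. *)
  by rewrite /ratio !hE// ea em inver gt_eqF// -EFin_expe EFinM.
rewrite survE es -EFinM !lee_fin; apply/andP; split.
  by rewrite ler_pdivrMr.
by rewrite mulrA ler_pdivlMr.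
Qed.
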